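(* Let $d\ge 1$, let $\mathcal{X}\subset\mathbb{R}^d$ be a bounded measurable set, and let $(K_n)_{n\geq 1}$ be a sequence of Markov kernels from $(\mathcal{X},\mathcal{B}(\mathcal{X}))$ to itself satisfying: (i) for all $n\geq 1$ and $x\in\mathcal{X}$, $K_n(x,\mathrm{d}y)=K_n(y|x)\lambda_d(\mathrm{d}y)$, where $K_n(\cdot|\cdot)$ is continuous on $\mathcal{X}^2$ and is such that $K_n(y|x)\geq \underline{K}_n>0$ for all $(x,y)\in\mathcal{X}^2$, for some constant $\underline{K}_n$; (ii) $\sum_{n=1}^{\infty}\underline{K}_n=\infty$. Let $\varphi:\mathcal{X}\to\mathbb{R}$ be a Borel measurable function, with $\varphi^*=\sup_{x\in\mathcal{X}}\varphi(x)$, such that there exist $x^*\in\mathcal{X}$ with $\varphi(x^* )=\varphi^*$ and $\delta_0>0$ such that the ball $\{x\in\mathbb{R}^d:\|x-x^*\|_\infty\leq\delta_0\}$ is contained in $\mathcal{X}$ and $\varphi$ is continuous on this ball. Let $(T_n)_{n\geq 1}$ be a sequence in $(0,\infty)$ with $\sum_{n=1}^{\infty}T_n\log(n)<\infty$. Let $(U_0^n)_{n\geq 0}$ be the sequence of i.i.d. uniform random variables in $[0,1)^{d+1}$ defined in the context, and $\phi_{\varphi,1:n}$ the simulated annealing maps defined in the context. Then, for all $x^0\in\mathcal{X}$, $$\lim_{n\rightarrow\infty}\varphi\Big(\phi_{\varphi,1:n}\big(x^0,U_0^{1:n}(\omega)\big)\Big)=\varphi^*\quad\text{for }\mathbb{P}\text{-almost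 every }\omega.$$
   Context: $\lambda_d$ is Lebesgue measure on $\mathbb{R}^d$, $\|z\|_\infty=\max_i|z_i|$, $\mathbb{N}=\{0,1,\dots\}$, and $u_{1:d}=(u_1,\dots,u_d)$. The probability space is $\Omega=[0,1)^{\mathbb{N}}$ with its Borel $\sigma$-algebra and $\mathbb{P}=\lambda_1^{\otimes\mathbb{N}}$. For $n\ge 0$, $U_0^n(\omega)=(\omega_{n(d+1)+1},\dots,\omega_{n(d+1)+d+1})$, so that $(U_0^n)_{n\ge 0}$ are i.i.d. uniform in $[0,1)^{d+1}$; $U_0^{1:n}=(U_0^1,\dots,U_0^n)$. Rosenblatt transformation: for a Markov kernel $K$ on $\mathcal{X}$ and $x\in\mathcal{X}$, $F_K(x,\cdot):\mathcal{X}\to[0,1]^d$ has $i$-th component at $y$ equal to the conditional c.d.f., evaluated at $y_i$, of the $i$-th coordinate given that the first $i-1$ coordinates equal $y_{1:i-1}$, under the distribution $K(x,\mathrm{d}y)$. The pseudo-inverse Rosenblatt transformation $F_K^{-1}(x,\cdot):[0,1]^d\to\mathcal{X}$ is obtained by successively inverting (generalized inverse) these one-dimensional conditional c.d.f.s: $y_1$ from $u_1$, then $y_2$ from $u_2$ given $y_1$, etc.; it maps the uniform distribution on $[0,1]^d$ to $K(x,\mathrm{d}y)$. Simulated annealing maps: for $x\in\mathcal{X}$ and $u\in[0,1)^{d+1}$, let $y_n(x,u_{1:d})=F_{K_n}^{-1}(x,u_{1:d})$, $A_n(x,u_{1:d})=\min\big(1,\exp\{(\varphi(y_n(x,u_{1:d}))-\varphi(x))/T_n\}\big)$,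 and $\phi_{\varphi,n}(x,u)=y_n(x,u_{1:d})$ if $u_{d+1}\le A_n(x,u_{1:d})$, $\phi_{\varphi,n}(x,u)=x$ otherwise. Define recursively $\phi_{\varphi,1:1}=\phi_{\varphi,1}$ and, for $n\ge 2$, $\phi_{\varphi,1:n}(x,u^{1:n})=\phi_{\varphi,n}\big(\phi_{\varphi,1:(n-1)}(x,u^{1:(n-1)}),u^n\big)$, where $u^{1:n}=(u^1,\dots,u^n)$ with $u^j\in[0,1)^{d+1}$. *)

(* Defs.v *)
From HB Require Import structures.
From mathcomp Require Import all_boot all_order all_algebra.
From mathcomp Require Import all_classical all_reals all_analysis.
From mathcomp Require Import measurable_realfun.

Set Implicit Arguments.
Unset Strict Implicit.
Unset Printing Implicit Defensive.
Import Order.TTheory GRing.Theory Num.Theory.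
Import numFieldNormedType.Exports.

Local Open Scope classical_set_scope.
Local Open Scope ring_scope.

(* Points of R^d are row vectors 'rV[R]_d; the library norm on them is the
   sup norm, and the sigma-algebra below is the Borel one. *)
Section borel_matrix.
Variables (R : realType) (m n : nat).

HB.instance Definition _ := @isMeasurable.Build default_measure_display
  'M[R]_(m, n) <<s (open : set (set 'M[R]_(m, n))) >>
  (@sigma_algebra0 _ setT _) (@sigma_algebraC _ _)
  (@sigma_algebra_bigcup _ setT _).

End borel_matrix.

Lemma open_measurable_mx (R : realType) (m n : nat) (U : set 'M[R]_(m, n)) :
  open U -> measurable U.
Proof. by move=> oU; exact: sub_sigma_algebra. Qed.

Lemma measurable_coord (R : realType) (m n : nat) (i : 'I_m) (j : 'I_n) :
  measurable_fun [set: 'M[R]_(m, n)] (fun M : 'M[R]_(m, n) => M i j).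
Proof.
move=> mT; apply: (measurability _ (RGenOpens.measurableE R)) => //.
move=> _ [_ [a [b ->] <-]].
rewrite setTI; apply: open_measurable_mx.
have /continuousP := @coord_continuous R m n i j.
by apply; exact: interval_open.
Qed.

Lemma measurable_fun_rV (R : realType) (n : nat) (disp : measure_display)
    (T : measurableType disp) (f : T -> 'rV[R]_n) :
  (forall j, measurable_fun setT (fun t => f t ord0 j)) ->
  measurable_fun setT f.
Proof.
move=> mf.
apply: (@measurability _ _ _ _ _ _ (open : set (set 'rV[R]_n))) => //.
move=> _ [U oU <-]; rewrite setTI.
pose c (p : 'rV[rat]_n * nat) : 'rV[R]_n := \row_j ratr (p.1 ord0 j).
pose B (p : 'rV[rat]_n * nat) : set 'rV[R]_n := ball (c p) p.2.+1%:R^-1.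
pose D : set ('rV[rat]_n * nat) := [set p | B p `<=` U].
have -> : f @^-1` U = \bigcup_(p in D) (f @^-1` (B p)).
  rewrite -preimage_bigcup; congr (_ @^-1` _); apply/seteqP; split; last first.
    by move=> v [p Dp Bp]; exact: Dp.
  move=> v Uv; have /nbhs_ballP[e /= e0 eU] := open_nbhs_nbhs (conj oU Uv).
  have [k _ ke] : \forall k \near \oo, k.+1%:R^-1 < e / 2 :> R.
    exact: near_infty_natSinv_lt (PosNum (divr_gt0 e0 (ltr0n _ 2))).
  have {}ke := ke _ (leqnn k).
  have k0 : 0 < k.+1%:R^-1 :> R by rewrite invr_gt0.
  have q_ j : exists q : rat, ball (ratr q : R) k.+1%:R^-1 (v ord0 j).
    have /rat_in_itvoo[q] :
      v ord0 j - k.+1%:R^-1 < v ord0 j + k.+1%:R^-1 :> R.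
      by rewrite ltrD2l gtrN.
    rewrite in_itv/= => /andP[q1 q2]; exists q.
    by rewrite /ball/= ltr_distlC; apply/andP; split; rewrite ?ltrBlDr// -ltrBlDr.
  pose q := \row_j (xchoose (q_ j)).
  have Bv : B (q, k) v.
    split=> // i j; rewrite (ord1 i) !mxE.
    exact: (xchooseP (q_ j)).
  exists (q, k) => // w Bw; apply: eU; apply: (@ball_splitr _ _ (c (q, k))).
  - by apply: le_ball (ltW ke) _ _.
  - by apply: le_ball (ltW ke) _ _.
rewrite bigcup_mkcond; apply: countable_bigcupT_measurable => [|p].
  exact: countableP.
case: ifPn => // _.
have -> : f @^-1` B p = \bigcap_(j in [set: 'I_n])
    (fun t => f t ord0 j) @^-1` ball (ratr (p.1 ord0 j) : R) p.2.+1%:R^-1.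
  apply/seteqP; split=> [t [_ Bt] j _|t Bt].
    by have := Bt ord0 j; rewrite mxE.
  split=> [|i j]; first by rewrite invr_gt0.
  by rewrite (ord1 i) mxE; exact: Bt.
apply: fin_bigcap_measurable => // j _.
rewrite -[X in measurable X]setTI; apply: mf => //.
by apply: open_measurable; exact: ball_open.
Qed.

Definition snoc (R : realType) (n : nat) (p : 'rV[R]_n * R) : 'rV[R]_n.+1 :=
  \row_j (if unlift ord_max j is Some k then p.1 ord0 k else p.2).

Lemma measurable_snoc (R : realType) (n : nat) :
  measurable_fun [set: 'rV[R]_n * R] (@snoc R n).
Proof.
apply: measurable_fun_rV => j.
have [k jk|jmax] := unliftP ord_max j.
  rewrite (_ : (fun _ => _) = (fun M : 'rV[R]_n => M ord0 k) \o fst).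
    by apply: measurableT_comp; [exact: measurable_coord|exact: measurable_fst].
  by apply/funext => p; rewrite /= mxE jk liftK.
rewrite (_ : (fun _ => _) = snd); first exact: measurable_snd.
by apply/funext => p; rewrite mxE jmax unlift_none.
Qed.

Section lebesgue.
Variable R : realType.
Local Open Scope ereal_scope.

Definition lebesgue_snoc (n : nat) (m : {measure set 'rV[R]_n -> \bar R}) :
    set 'rV[R]_n.+1 -> \bar R :=
  pushforward (m \x (@lebesgue_measure R)) (@snoc R n).

HB.instance Definition _ n m := Measure.copy (@lebesgue_snoc n m)
  (measure_function_pushforward__canonical__measure_function_Measure
    (m \x (@lebesgue_measure R)) (@measurable_snoc R n)).

(* lambda_n; lambda_0 is the unit mass at the only point of R^0. *)
Fixpoint lebesgue_rV (n : nat) : {measure set 'rV[R]_n -> \bar R} :=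
  if n is n'.+1 then lebesgue_snoc (lebesgue_rV n')
  else dirac (0 : 'rV[R]_0)%R.

End lebesgue.

Section probability_space.
Variable R : realType.

Definition unit_itv : Type := {r : R | r \in `[0, 1[}.

Lemma unit_itv0 : (0 : R) \in `[0, 1[.
Proof. by rewrite in_itv/= lexx ltr01. Qed.

(* Omega = [0,1)^N, with the sigma-algebra generated by the coordinates; since
   N is countable this is the Borel one of the product topology. *)
Definition Omega : Type := nat -> unit_itv.

HB.instance Definition _ := gen_eqMixin Omega.
HB.instance Definition _ := gen_choiceMixin Omega.
HB.instance Definition _ := isPointed.Build Omega (fun=> exist _ 0 unit_itv0).

Definition cylinder : set (set Omega) :=
  \bigcup_(i in [set: nat])
    preimage_set_system setT (fun w : Omega => val (w i)) measurable.

HB.instance Definition _ := @isMeasurable.Build default_measure_display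
  Omega <<s cylinder >>
  (@sigma_algebra0 _ setT _) (@sigma_algebraC _ _)
  (@sigma_algebra_bigcup _ setT _).

(* P = lambda_1^{(x) N}. The library has no infinite products of measures; this
   is the property on finite-dimensional rectangles that determines P. *)
Definition is_product_lebesgue (P : probability Omega R) : Prop :=
  forall (n : nat) (B : nat -> set R), (forall i, measurable (B i)) ->
  P [set w | forall i, (i < n)%N -> B i (val (w i))] =
  (\prod_(i < n) lebesgue_measure (B i `&` `[0%R, 1%R[))%E.

(* The coordinate omega_0 is never used. *)
Definition U0 (d n : nat) (w : Omega) : 'rV[R]_(d + 1) :=
  \row_j val (w (n * (d + 1) + 1 + j)%N).

End probability_space.

Section rosenblatt.
Variables (R : realType) (d : nat).
Local Notation T := 'rV[R]_d.

(* Keeps the coordinates of index < i and replaces the other ones by 0; stands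
   for the initial segment (y_j)_{j < i} of y. *)
Definition prefix (i : nat) (y : T) : T :=
  \row_(j < d) (if (j < i)%N then y ord0 j else 0).

(* Q i (x, prefix i y) is a regular version, jointly measurable in (x, y), of
   the conditional distribution of the coordinate i given the coordinates of
   index < i, under K x. *)
Definition is_cond_distr (X : set T) (K : R.-pker T ~> T)
    (Q : 'I_d -> R.-pker (T * T)%type ~> R) : Prop :=
  forall x, X x -> forall (i : 'I_d) (A : set T) (B : set R),
  measurable A -> measurable B ->
  (K x [set y | A (prefix i y) /\ B (y ord0 i)] =
   \int[K x]_(y in [set y | A (prefix i y)]) Q i (x, prefix i y) B)%E.

Variables (X : set T) (Q : 'I_d -> R.-pker (T * T)%type ~> R).

(* The i-th component of F_K(x, y) is cond_cdf i x y (y ord0 i). *)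
Definition cond_cdf (i : 'I_d) (x y : T) (t : R) : R :=
  fine (Q i (x, prefix i y) `]-oo, t]%classic).

Definition ginv (F : R -> R) (u : R) : R := inf [set t | u <= F t].

Fixpoint rosenblatt_rec (k : nat) (x u : T) : T :=
  if k is k'.+1 then
    let y := rosenblatt_rec k' x u in
    \row_(j < d) (if j == k' :> nat then ginv (cond_cdf j x y) (u ord0 j)
                  else y ord0 j)
  else 0.

(* F_K^{-1}(x, .). The vector of successive inverses lies in X for almost every
   u only; on the exceptional set x is taken, so that the values are in X. *)
Definition rosenblatt_inv (x u : T) : T :=
  let y := rosenblatt_rec d x u in if y \in X then y else x.

End rosenblatt.

Section annealing.
Variables (R : realType) (d : nat).
Local Notation T := 'rV[R]_d.
Variables (X : set T) (Q : nat -> 'I_d -> R.-pker (T * T)%type ~> R).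
Variables (phi : T -> R) (temp : nat -> R).

Definition acceptance (n : nat) (x y : T) : R :=
  Num.min 1 (expR ((phi y - phi x) / temp n)).

(* The first d coordinates of u are lsubmx u, the last one is rsubmx u. *)
Definition sa_step (n : nat) (x : T) (u : 'rV[R]_(d + 1)) : T :=
  let y := rosenblatt_inv X (Q n) x (lsubmx u) in
  if rsubmx u ord0 ord0 <= acceptance n x y then y else x.

(* phi_{1:n}(x, u^{1:n}), reading only the terms u 1, ..., u n of u; the value
   at n = 0 is x, so that sa 1 is sa_step 1. *)
Fixpoint sa (n : nat) (x : T) (u : nat -> 'rV[R]_(d + 1)) : T :=
  if n is n'.+1 then sa_step n (sa n' x u) (u n) else x.

End annealing.

(* Main.v *)
Require Import Defs.
From HB Require Import structures.
From mathcomp Require Import all_boot all_order all_algebra.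
From mathcomp Require Import all_classical all_reals all_analysis.
From mathcomp Require Import measurable_realfun zify ring lra.

(* A step with coin u loses at most temp n * - ln u, and u >= 1 / (n (n + 1))
   for all large n almost surely (Borel-Cantelli); as temp n * ln n is summable,
   the sequence of values is nondecreasing up to a summable error. Given the
   past, the n-th proposal falls in a fixed small ball around xstar with
   probability at least Kmin n times the volume of the ball, because the inverse
   Rosenblatt transform sends the uniform law to K n x. As Kmin is not summable,
   this happens infinitely often almost surely, and each time either the current
   or the next state is nearly optimal. *)

Set Implicit Arguments.
Unset Strict Implicit.
Unset Printing Implicit Defensive.
Import Order.TTheory GRing.Theory Num.Theory.
Import numFieldNormedType.Exports.

Local Open Scope classical_set_scope.
Local Open Scope ring_scope.

(** [P] is known only through its values on rectangles, and each proposal depends on the past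
    through the current state, so the events of hitting the ball are not independent. One identity
    handles both points: [P] is the law of a past spliced with a fresh sequence. Integrating over
    the fresh part first, a proposal from a fixed state misses the ball with probability at most 1 -
    c, where c does not depend on the state; iterating bounds a long run of misses by exp(- sum of
    c). The same identity, used coordinate by coordinate, gives the law of the inverse Rosenblatt
    transform. The threshold 1 / (n (n + 1)) is summable by telescoping, while its logarithm stays
    of order ln n. *)

Local Notation pushforward_meas :=
  measure_function_pushforward__canonical__measure_function_Measure.

(** * Independence of past and future *)

Section omega.
Variable R : realType.
Local Notation Om := (Omega R).

Lemma measurable_omega (i : nat) : measurable_fun [set: Om] (fun w => val (w i)).
Proof.
move=> _ B mB; rewrite setTI; apply: sub_sigma_algebra.
by exists i => //; exists B => //; rewrite setTI.
Qed.

Lemma measurable_fun_omega disp (T : measurableType disp) (f : T -> Om) :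
  (forall i, measurable_fun setT (fun t => val (f t i))) ->
  measurable_fun setT f.
Proof.
move=> mf; apply: (@measurability _ _ _ _ _ _ (@cylinder R)) => //.
move=> _ [_ [i _ [B mB <-]] <-].
by rewrite !setTI -[X in measurable X]setTI; apply: (mf i).
Qed.

Definition rect (n : nat) (B : nat -> set R) : set Om :=
  [set w | forall i, (i < n)%N -> B i (val (w i))].

Definition rects : set (set Om) :=
  [set E | exists n B, (forall i, measurable (B i)) /\ E = rect n B].

Lemma measurable_rect n B : (forall i, measurable (B i)) -> measurable (rect n B).
Proof.
move=> mB; have -> : rect n B =
    \bigcap_(i in `I_n) ((fun w : Om => val (w i)) @^-1` B i).
  by apply/seteqP; split.
apply: fin_bigcap_measurable => // i _.
by rewrite -[X in measurable X]setTI; exact: measurable_omega.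
Qed.

Lemma setI_closed_rects : setI_closed rects.
Proof.
move=> _ _ [n [B [mB ->]]] [n' [B' [mB' ->]]].
(* The two lengths may differ: the missing sides of the shorter rectangle are padded with [setT]. *)
exists (maxn n n'), (fun i => (if (i < n)%N then B i else setT) `&`
  (if (i < n')%N then B' i else setT)); split.
  by move=> i; apply: measurableI; case: ifP.
apply/seteqP; split=> w.
  by move=> [wB wB'] i _; split; case: ifP => // ni; [exact: wB|exact: wB'].
move=> wB; split=> i ni.
  by have [] := wB i (leq_trans ni (leq_maxl _ _)); rewrite ni.
by have [] := wB i (leq_trans ni (leq_maxr _ _)); rewrite ni.
Qed.

Lemma measurable_omegaE : (measurable : set (set Om)) = <<s rects >>.
Proof.
apply/seteqP; split; apply: smallest_sub.
- exact: smallest_sigma_algebra.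
- move=> _ [i _ [B mB <-]]; apply: sub_sigma_algebra.
  exists i.+1, (fun j => if j == i then B else setT); split.
    by move=> j; case: ifP.
  rewrite setTI; apply/seteqP; split=> w.
    by move=> Bw j _; case: eqP => // ->.
  by move=> /(_ i (ltnSn i)); rewrite eqxx.
- exact: sigma_algebra_measurable.
- by move=> _ [n [B [mB ->]]]; exact: measurable_rect.
Qed.

(** Rectangles form a generating pi-system, and the rectangle of length 0 is the full space, so a
    constant exhausting sequence is enough. *)
Lemma omega_measure_unique (m1 m2 : {measure set Om -> \bar R}) :
  (m1 setT < +oo)%E ->
  (forall n B, (forall i, measurable (B i)) -> m1 (rect n B) = m2 (rect n B)) ->
  forall E, measurable E -> m1 E = m2 E.
Proof.
move=> m1oo m12; apply: (measure_unique rects (fun=> setT)) => //.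
- exact: measurable_omegaE.
- exact: setI_closed_rects.
- by move=> _; exists 0%N, (fun=> setT); split => //; apply/seteqP; split.
- by rewrite bigcup_const.
- by move=> _ [n [B [mB ->]]]; exact: m12.
Qed.

(* The law of splice m w w' for independent w, w' is again P: this is how the
   independence of the coordinates before and after m is used. *)
Definition splice (m : nat) (w w' : Om) : Om :=
  fun i => if (i < m)%N then w i else w' (i - m)%N.

Lemma measurable_splice m :
  measurable_fun setT (fun p : Om * Om => splice m p.1 p.2).
Proof.
apply: measurable_fun_omega => i; rewrite /splice; case: ltnP => _.
  exact: (measurableT_comp (measurable_omega i) measurable_fst).
exact: (measurableT_comp (measurable_omega _) measurable_snd).
Qed.

Variable P : probability Om R.
Hypothesis Pprod : is_product_lebesgue P.

(** By uniqueness it suffices to take a rectangle. Its preimage under splicing is a product: the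
    sides before [m] constrain [w], the others, re-indexed from 0, constrain [w']. *)
Lemma probability_splice m (E : set Om) : measurable E ->
  P E = (\int[P]_w P [set w' | E (splice m w w')])%E.
Proof.
move=> mE.
pose J := pushforward (P \x P)%E (fun p : Om * Om => splice m p.1 p.2).
have mJ := measurable_splice m.
pose Jm : {measure set Om -> \bar R} :=
  pushforward_meas (P \x P)%E mJ.
suff -> : P E = J E.
  rewrite /J /pushforward /= /product_measure1.
  apply: eq_integral => w _ /=; congr (P _).
  by apply/seteqP; split => w' /=; rewrite /xsection/= in_setE.
apply: (@omega_measure_unique P Jm _ _ E mE).
  exact: (le_lt_trans (probability_le1 P measurableT) (ltry _)).
move=> n B mB; rewrite [LHS](Pprod n mB).
change ((\prod_(i < n) lebesgue_measure (B i `&` `[0%R, 1%R[))%E = J (rect n B)).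
rewrite /J /pushforward.
rewrite (_ : _ @^-1` _ = rect (minn n m) B `*` rect (n - m)%N (fun i => B (m + i)%N)).
  rewrite product_measure1E; [|exact: measurable_rect|exact: measurable_rect].
  rewrite [X in _ = (X * _)%E](Pprod _ mB).
  rewrite [X in _ = (_ * X)%E](Pprod _ (fun i => mB (m + i)%N)).
  have [nm|/ltnW mn] := leqP n m.
    (* Here [n <= m] unfolds to [n - m == 0]: nothing constrains [w']. *)
    by rewrite (eqP nm) big_ord0 mule1.
  by rewrite -[in LHS](subnKC mn) big_split_ord.
apply/seteqP; split=> [[w w']/= H|[w w'] /= [H H'] i ni].
  split=> i /= ni.
    have := H i; rewrite /splice; move: ni; rewrite leq_min => /andP[ni im].
    by rewrite im; exact.
  have := H (m + i)%N; rewrite /splice [(m + i < m)%N]ltnNge leq_addr/= addKn; apply.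
  by rewrite -ltn_subRL.
rewrite /splice; case: ltnP => im.
  by apply: H; rewrite leq_min ni.
by have := H' (i - m)%N; rewrite subnKC//; apply;
  rewrite ltn_sub2r// (leq_ltn_trans im).
Qed.

Lemma measurable_fun_prob_splice m (E : set Om) : measurable E ->
  measurable_fun setT (fun w => P [set w' | E (splice m w w')]).
Proof.
move=> mE; pose A := (fun p : Om * Om => splice m p.1 p.2) @^-1` E.
have mA : measurable A.
  by rewrite -[X in measurable X]setTI; exact: measurable_splice.
rewrite (_ : (fun _ => _) = P \o xsection A); first exact: measurable_fun_xsection.
apply/funext => w /=; congr (P _).
by apply/seteqP; split => w' /=; rewrite /xsection/= in_setE.
Qed.

Lemma probability_omega0 B : measurable B ->
  P [set w | B (val (w 0%N))] = lebesgue_measure (B `&` `[0%R, 1%R[).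
Proof.
move=> mB; have := Pprod 1%N (fun _ => mB); rewrite big_ord1 => <-.
by congr (P _); apply/seteqP; split=> w /= H; [case|exact: H].
Qed.
End omega.

(** * The inverse transform *)

Section inverse_transform.
Variable R : realType.

(** [cond_cdf Q i x y] is convertible to this function for [mu := Q i (x, prefix i y)], so the
    one-dimensional facts below apply to it directly. *)
Definition dcdf (mu : set R -> \bar R) (t : R) : R := fine (mu `]-oo, t]%classic).

Section one_measure.
Variable mu : {measure set R -> \bar R}.
Hypothesis mu1 : mu setT = 1%E.

(** A copy of [mu] with the structure of a probability. The identity, as a random variable on it,
    has law [mu], which gives access to the theory of [cdf]. *)
Let pmu := mu : set R -> \bar R.
#[local] HB.instance Definition _ := Measure.on pmu.
#[local] HB.instance Definition _ := Measure_isProbability.Build _ _ _ pmu mu1.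

Let idR : R -> R := idfun.

#[local] HB.instance Definition _ :=
  @isMeasurableFun.Build _ _ R R idR (@measurable_id _ _ setT).

Let X : {RV pmu >-> R} := idR.

Let cdfE t : (dcdf mu t)%:E = cdf X t.
Proof.
rewrite /dcdf fineK//; apply: (fin_num_measure pmu).
exact: measurable_itv.
Qed.

Lemma dcdf_nondecreasing (s t : R) : s <= t -> dcdf mu s <= dcdf mu t.
Proof. by move=> st; rewrite -lee_fin !cdfE; exact: cdf_nondecreasing. Qed.

Lemma dcdf_ge0 t : 0 <= dcdf mu t.
Proof. by rewrite -lee_fin cdfE cdf_ge0. Qed.

Lemma dcdf_le1 t : dcdf mu t <= 1.
Proof. by rewrite -lee_fin cdfE cdf_le1. Qed.

Lemma measure_itvoy x : mu `]x, +oo[%classic = (1 - dcdf mu x)%:E.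
Proof.
rewrite EFinB cdfE -[LHS]/(pmu _) -setCitvl probability_setC//.
Qed.

Lemma dcdf_gt (u : R) : u < 1 -> exists t, u < dcdf mu t.
Proof.
move=> u1.
have [M [_ MP]] : \forall t \near +oo, (u%:E < cdf X t)%E.
  have /(_ [set y | u%:E < y]%E) := cvg_cdfy1 X; apply.
  exact: (@open_ereal_gt' _ 1%E u%:E).
by exists (M + 1); rewrite -lte_fin cdfE; apply: MP; rewrite ltrDl.
Qed.

Lemma dcdf_lt (u : R) : 0 < u -> exists t, dcdf mu t < u.
Proof.
move=> u0.
have [M [_ MP]] : \forall t \near -oo, (cdf X t < u%:E)%E.
  have /(_ [set y | y < u%:E]%E) := cvg_cdfNy0 X; apply.
  exact: (@open_ereal_lt' _ 0%E u%:E).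
by exists (M - 1); rewrite -lte_fin cdfE; apply: MP; rewrite gtrBl.
Qed.

(** Right continuity in the form needed for [ginv]: the infimum of the t with u <= F t is
    attained. *)
Lemma dcdf_right_closed (u s : R) :
  (forall t, s < t -> u <= dcdf mu t) -> u <= dcdf mu s.
Proof.
move=> us; rewrite -lee_fin cdfE.
apply: (cvge_ge _ (@cdf_right_continuous _ _ _ _ X s)).
near=> t; rewrite -cdfE lee_fin; apply: us; near: t; exact: nbhs_right_gt.
Unshelve. all: by end_near. Qed.

(** The Galois connection between F and its generalized inverse. The limits of F at +oo and -oo make
    the set under the infimum nonempty (u < 1) and bounded below (0 < u). *)
Lemma ginv_le (u t : R) : 0 < u -> u < 1 ->
  (ginv (dcdf mu) u <= t) = (u <= dcdf mu t).
Proof.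
move=> u0 u1; set S := [set t | u <= dcdf mu t].
have S0 : S !=set0 by have [s /ltW us] := dcdf_gt u1; exists s.
have lbS : has_lbound S.
  have [s su] := dcdf_lt u0; exists s => r /= ur.
  by rewrite leNgt; apply/negP => /ltW/dcdf_nondecreasing;
    rewrite leNgt (lt_le_trans su).
apply/idP/idP => [|ut]; last exact: ge_inf.
move=> /dcdf_nondecreasing; apply: le_trans; apply: dcdf_right_closed => r.
move=> /(inf_lt S0)[v Sv /ltW/dcdf_nondecreasing]; exact: le_trans.
Qed.

End one_measure.

Lemma measurable_snd_co01 disp (S : measurableType disp) :
  measurable [set p : S * R | 0 <= p.2 < 1].
Proof.
rewrite (_ : [set _ | _] = setT `*` `[0%R, 1%R[); first exact: measurableX.
by apply/seteqP; split=> -[t u] /=; rewrite in_itv//= => -[].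
Qed.

(* At u = 0 the infimum defining ginv ranges over all of R and takes a junk
   value, which does not depend on the measure. *)
Lemma measurable_ginv disp (S : measurableType disp) (kap : R.-pker S ~> R) :
  measurable_fun [set p : S * R | 0 <= p.2 < 1]
    (fun p : S * R => ginv (dcdf (kap p.1)) p.2).
Proof.
move=> mD; apply: (measurability _ (RGenOInfty.measurableE R)) => //.
move=> _ [_ [x ->] <-].
have mH : measurable [set p : S * R | dcdf (kap p.1) x < p.2].
  have mlt : measurable_fun setT (fun p : S * R => dcdf (kap p.1) x < p.2).
    apply: measurable_fun_ltr; last exact: measurable_snd.
    apply: measurableT_comp => //.
    apply: (measurableT_comp (f := fun s => kap s `]-oo, x]%classic)) => //.
    exact: measurable_kernel.
  have := mlt measurableT [set true]; rewrite setTI => /(_ I).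
  by congr (measurable _); apply/seteqP; split.
pose c := inf [set: R].
have kap1 s : kap s setT = 1%E by exact: prob_kernel.
have ginv0 s : ginv (dcdf (kap s)) 0 = c.
  by congr inf; apply/seteqP; split => // t _ /=; exact: dcdf_ge0.
(* For 0 < u < 1, [ginv_le] turns x < ginv into F x < u; the slice u = 0 is kept or dropped as a
   whole, according to x < c. *)
rewrite (_ : _ `&` _ = ([set p | dcdf (kap p.1) x < p.2] `&`
    (setT `*` `]0%R, 1%R[)) `|` (setT `*` [set u | u = 0 /\ x < c])).
  apply: measurableU.
    by apply: measurableI => //; exact: measurableX.
  apply: measurableX => //.
  have [xc|cx] := ltP x c.
    rewrite (_ : [set _ | _] = [set 0])//.
    by apply/seteqP; split=> [u []//|u ->].
  by rewrite (_ : [set _ | _] = set0)//; apply/seteqP; split=> // u [].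
apply/seteqP; split=> -[s u] /=; rewrite !in_itv/= !andbT.
  case=> /andP[]; rewrite le_eqVlt => /predU1P[<- _ xg|u0 u1].
    by right; split => //; split => //; rewrite -(ginv0 s).
  by rewrite ltNge ginv_le// -ltNge => h; left; split => //; rewrite u0 u1.
case=> [[h [_ /andP[u0 u1]]]|[_ [-> h]]].
  by rewrite (ltW u0) u1 ltNge ginv_le// -ltNge.
by rewrite lexx ltr01 ginv0.
Qed.

Lemma measurable_ginv_comp disp (S : measurableType disp)
    (kap : R.-pker S ~> R) disp' (Y : measurableType disp')
    (s : Y -> S) (u : Y -> R) :
  measurable_fun setT s -> measurable_fun setT u -> (forall y, 0 <= u y < 1) ->
  measurable_fun setT (fun y => ginv (dcdf (kap (s y))) (u y)).
Proof.
move=> ms mu u01.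
apply: (measurable_comp _ _ (@measurable_ginv _ _ kap) (measurable_fun_pair ms mu)).
- exact: measurable_snd_co01.
- by move=> _ [y _ <-] /=.
Qed.

End inverse_transform.

Section inverse_transform_law.
Variable R : realType.
Variable P : probability (Omega R) R.
Hypothesis Pprod : is_product_lebesgue P.
Variables (disp : measure_display) (S : measurableType disp).
Variable kap : R.-pker S ~> R.

Lemma val_omega01 (w : Omega R) i : 0 <= val (w i) < 1.
Proof. by have := valP (w i); rewrite in_itv. Qed.

(** Inverse transform sampling. Open rays to the right form a generating pi-system, and on them
    [ginv_le] leaves only the length of ]F x, 1[ to compute. *)
Lemma ginv_uniform_law (s : S) B : measurable B ->
  P [set w | B (ginv (dcdf (kap s)) (val (w 0%N)))] = kap s B.
Proof.
move=> mB; have kap1 : kap s setT = 1%E by exact: prob_kernel.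
pose g (w : Omega R) := ginv (dcdf (kap s)) (val (w 0%N)).
have mg : measurable_fun setT g.
  apply: measurable_ginv_comp; first exact: measurable_cst.
    exact: measurable_omega.
  by move=> w; exact: val_omega01.
pose m1 : {measure set R -> \bar R} :=
  pushforward_meas P mg.
change (m1 B = kap s B).
apply: (@measure_unique _ _ _ (@RGenOInfty.G R) (fun n => `]- n%:R, +oo[%classic)
  _ _ _ _ m1 (kap s) _ _ B mB).
- exact: RGenOInfty.measurableE.
- move=> _ _ [x ->] [y ->]; exists (Num.max x y).
  apply/seteqP; split=> t /=; rewrite !in_itv/= !andbT gt_max.
    by move=> [-> ->].
  by move=> /andP[].
- by move=> n; eexists.
- apply/seteqP; split => // t _; exists (Num.bound t) => //=.
  by rewrite in_itv/= andbT ltrNl unstable.ltrNbound.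
- move=> _ [x ->]; set F := dcdf (kap s).
  have F01 : 0 <= F x <= 1 by rewrite dcdf_ge0// dcdf_le1.
  (* At u = 0 the value of [ginv] is arbitrary and may exceed [x]; this adds at most the null set
     {0}. *)
  pose Z := [set u : R | u = 0 /\ x < ginv F 0].
  have Z0 : Z `<=` [set 0] by move=> u [].
  have mZ : measurable Z.
    have [xc|cx] := ltP x (ginv F 0).
      rewrite (_ : Z = [set 0])//.
      by apply/seteqP; split=> [u []//|u ->].
    by rewrite (_ : Z = set0)//; apply/seteqP; split=> // u []; rewrite ltNge cx.
  transitivity (P [set w | (`]F x, 1%R[ `|` Z) (val (w 0%N))]).
    congr (P _); apply/seteqP; split => w /=; rewrite !in_itv/= !andbT.
      have /andP[] := val_omega01 w 0; rewrite le_eqVlt => /predU1P[w0 _ xg|u0 u1].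
        by right; split; rewrite ?w0 // -w0.
      by rewrite /g ltNge ginv_le// -ltNge => h; left; rewrite h u1.
    case=> [/andP[h u1]|[w0]]; last by rewrite /g [val _]w0.
    have u0 : 0 < val (w 0%N) by apply: le_lt_trans h; case/andP: F01.
    by rewrite /g ltNge ginv_le// -ltNge.
  rewrite probability_omega0//; last exact: measurableU.
  rewrite setIidl; last first.
    move=> u [|[-> _]] /=; rewrite !in_itv/= ?lexx ?ltr01// => /andP[Fu ->].
    by rewrite andbT (ltW (le_lt_trans _ Fu))//; case/andP: F01.
  have Z00 : lebesgue_measure Z = 0%E.
    by apply/eqP; rewrite -measure_le0 -(lebesgue_measure_set1 (0 : R)) le_measure ?inE.
  rewrite measureU0//.
  rewrite [LHS]lebesgue_measure_itv/= lte_fin.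
  rewrite measure_itvoy//; case: ltP => // F1.
  by rewrite (@le_anti _ R 1 (F x)) ?subrr// F1; case/andP: F01.
- by move=> n; apply: (le_lt_trans (probability_le1 P _) (ltry _));
    rewrite -[X in measurable X]setTI; apply: (mg measurableT).
Qed.
End inverse_transform_law.

(** * The inverse Rosenblatt transform *)

Section rosenblatt_law.
Variables (R : realType) (d : nat).
Local Notation T := 'rV[R]_d.

(** Under [P] a uniform vector. It starts at coordinate 0 because the fresh sequence of a splice is
    read from there. *)
Definition unif (w : Omega R) : T := \row_j val (w j).

Lemma measurable_unif : measurable_fun setT unif.
Proof.
apply: measurable_fun_rV => j.
by under eq_fun do rewrite mxE; exact: measurable_omega.
Qed.

Lemma measurable_prefix i : measurable_fun setT (@Defs.prefix R d i).
Proof.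
apply: measurable_fun_rV => j; under eq_fun do rewrite mxE.
by case: (j < i)%N; [exact: measurable_coord|exact: measurable_cst].
Qed.

Definition set_coord (i : nat) (p : T * R) : T :=
  \row_(j < d) (if j == i :> nat then p.2 else p.1 ord0 j).

Lemma measurable_set_coord i : measurable_fun setT (set_coord i).
Proof.
apply: measurable_fun_rV => j; under eq_fun do rewrite mxE.
case: (j == i :> nat); first exact: measurable_snd.
exact: (measurableT_comp (measurable_coord _ _) measurable_fst).
Qed.

Lemma prefixS (i : 'I_d) (y : T) : 
  Defs.prefix i.+1 y = set_coord i (Defs.prefix i y, y ord0 i).
Proof.
apply/rowP => j; rewrite !mxE ltnS leq_eqVlt /=.
by case: eqP => //= ji; have -> : j = i by exact: val_inj.
Qed.

Lemma prefix_id (y : T) : Defs.prefix d y = y.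
Proof. by apply/rowP => j; rewrite mxE ltn_ord. Qed.

Lemma prefix0 (y : T) : Defs.prefix 0 y = 0.
Proof. by apply/rowP => j; rewrite !mxE. Qed.

Variable Q : 'I_d -> R.-pker (T * T)%type ~> R.

Lemma rosenblatt_recS (i : 'I_d) x u : rosenblatt_rec Q i.+1 x u =
  set_coord i (rosenblatt_rec Q i x u,
    ginv (cond_cdf Q i x (rosenblatt_rec Q i x u)) (u ord0 i)).
Proof.
apply/rowP => j; rewrite !mxE/=; case: eqP => // ji.
by have -> : j = i by exact: val_inj.
Qed.

(** The coordinates not yet computed are 0, the same convention as in [prefix]; this lets partial
    transforms and prefixes have the same law. *)
Lemma prefix_rosenblatt_rec k x u :
  Defs.prefix k (rosenblatt_rec Q k x u) = rosenblatt_rec Q k x u.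
Proof.
elim: k => [|k IH] /=; first by rewrite prefix0.
apply/rowP => j; rewrite !mxE ltnS leq_eqVlt; case: eqP => //= _.
by rewrite -{2}IH mxE.
Qed.

(** Used to see that the first [k] steps are unaffected when the coordinates from [k] on are
    redrawn. *)
Lemma eq_rosenblatt_rec k x (u v : T) :
  (forall j : 'I_d, (j < k)%N -> u ord0 j = v ord0 j) ->
  rosenblatt_rec Q k x u = rosenblatt_rec Q k x v.
Proof.
elim: k => [//|k IH] uv /=.
rewrite IH; last by move=> j jk; apply: uv; exact: ltnW.
by apply/rowP => j; rewrite !mxE; case: eqP => // jk; rewrite uv// jk.
Qed.

Lemma measurable_rosenblatt_rec disp (Y : measurableType disp) (f g : Y -> T) k :
  measurable_fun setT f -> measurable_fun setT g ->
  (forall y j, 0 <= g y ord0 j < 1) ->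
  measurable_fun setT (fun y => rosenblatt_rec Q k (f y) (g y)).
Proof.
move=> mf mg g01; elim: k => [|k IH] /=; first exact: measurable_cst.
apply: measurable_fun_rV => j; under eq_fun do rewrite mxE.
case: (j == k :> nat); last first.
  exact: (measurableT_comp (measurable_coord _ _) IH).
apply: measurable_ginv_comp => //.
  apply: measurable_fun_pair => //.
  exact: (measurableT_comp (measurable_prefix _) IH).
exact: (measurableT_comp (measurable_coord _ _) mg).
Qed.

Variables (X : set T) (K : R.-pker T ~> T).
Hypothesis Qcond : is_cond_distr X K Q.
Variable P : probability (Omega R) R.
Hypothesis Pprod : is_product_lebesgue P.

(** Induction on the number of coordinates. Splicing at [k] makes the next uniform fresh, so given
    the first steps the new coordinate has law [Q i] at their prefix; the induction hypothesis gives
    the law of that prefix, and [Qcond] reassembles the joint law. *)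
Lemma rosenblatt_rec_law k x C : (k <= d)%N -> X x -> measurable C ->
  P [set w | C (rosenblatt_rec Q k x (unif w))] = K x [set y | C (Defs.prefix k y)].
Proof.
move=> + Xx; elim: k C => [|k IH] C kd mC.
  (* At [k = 0] both sides are the Dirac mass at 0. *)
  under [in RHS]eq_set do rewrite prefix0.
  have [C0|C0] := pselect (C 0).
    rewrite (_ : [set _ | _] = setT); last by apply/seteqP; split.
    rewrite [LHS](@probability_setT _ _ _ P).
    rewrite (_ : [set _ | _] = setT); last by apply/seteqP; split.
    by rewrite prob_kernel.
  rewrite (_ : [set _ | _] = set0); last by apply/seteqP; split.
  rewrite (_ : [set _ | C 0] = set0); last by apply/seteqP; split.
  by rewrite !measure0.
pose i := Ordinal kd.
have -> : [set w | C (rosenblatt_rec Q k.+1 x (unif w))] =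
  [set w | (set_coord k @^-1` C) (rosenblatt_rec Q k x (unif w),
     ginv (cond_cdf Q i x (rosenblatt_rec Q k x (unif w))) (val (w k)))].
  by apply/seteqP; split=> w; rewrite /= -/(rosenblatt_rec Q k.+1 _ _)
    (rosenblatt_recS i) mxE.
have -> : [set y | C (Defs.prefix k.+1 y)] =
    [set y | (set_coord k @^-1` C) (Defs.prefix k y, y ord0 i)].
  by apply/seteqP; split=> y; rewrite /= (prefixS i).
have {mC} : measurable (set_coord k @^-1` C).
  by rewrite -[X in measurable X]setTI; exact: measurable_set_coord.
(* From here [C] is any measurable set of pairs (prefix, next coordinate), so two laws on a product
   are compared, and products [A] x [B] suffice. *)
move: (_ @^-1` C) => {}C mC.
have mrr : measurable_fun setT (fun w => rosenblatt_rec Q k x (unif w)).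
  apply: measurable_rosenblatt_rec => //; first exact: measurable_unif.
  by move=> w j; rewrite mxE; exact: val_omega01.
have mL : measurable_fun setT (fun w => (rosenblatt_rec Q k x (unif w),
     ginv (cond_cdf Q i x (rosenblatt_rec Q k x (unif w))) (val (w k)))).
  apply: measurable_fun_pair => //; apply: measurable_ginv_comp.
  - apply: measurable_fun_pair; first exact: measurable_cst.
    exact: (measurableT_comp (measurable_prefix _) mrr).
  - exact: measurable_omega.
  - by move=> w; exact: val_omega01.
have mN : measurable_fun setT (fun y : T => (Defs.prefix k y, y ord0 i)).
  apply: measurable_fun_pair; first exact: measurable_prefix.
  exact: measurable_coord.
pose m1 : {measure set (T * R) -> \bar R} :=
  pushforward_meas P mL.
pose m2 : {measure set (T * R) -> \bar R} :=
  pushforward_meas (K x) mN.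
change (m1 C = m2 C).
pose G := [set A `*` B | A in @measurable _ T & B in @measurable _ R].
apply: (@measure_unique _ _ _ G (fun=> setT) _ _ _ _ m1 m2 _ _ C mC).
- exact: measurable_prod_measurableType.
- move=> _ _ [A1 mA1 [B1 mB1 <-]] [A2 mA2 [B2 mB2 <-]]; rewrite -setXI.
  by exists (A1 `&` A2); [exact: measurableI|
    exists (B1 `&` B2) => //; exact: measurableI].
- by move=> _; exists setT => //; exists setT => //; rewrite setXTT.
- by rewrite bigcup_const.
- move=> _ [A mA [B mB <-]].
  have mLAB : measurable [set w | A (rosenblatt_rec Q k x (unif w)) /\
     B (ginv (cond_cdf Q i x (rosenblatt_rec Q k x (unif w))) (val (w k)))].
    rewrite -[X in measurable X]setTI; apply: (mL measurableT (A `*` B)).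
    exact: measurableX.
  transitivity (P [set w | A (rosenblatt_rec Q k x (unif w)) /\
     B (ginv (cond_cdf Q i x (rosenblatt_rec Q k x (unif w))) (val (w k)))]) => //.
  rewrite (probability_splice Pprod k mLAB).
  transitivity (K x [set y | A (Defs.prefix i y) /\ B (y ord0 i)]) => //.
  rewrite (Qcond Xx)//.
  pose mu1 : {measure set T -> \bar R} :=
    pushforward_meas P mrr.
  pose mu2 : {measure set T -> \bar R} :=
    pushforward_meas (K x) (@measurable_prefix k).
  have mQ : measurable_fun A (fun z => Q i (x, z) B).
    apply: measurable_funTS.
    exact: (measurableT_comp (measurable_kernel (Q i) B mB) (measurable_pair1 x)).
  transitivity (\int[mu2]_(z in A) Q i (x, z) B)%E; last first.
    exact: (ge0_integral_pushforward (measurable_prefix k)).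
  (* The induction hypothesis says that the two image laws agree; it moves the integral from [K x]
     to [P]. *)
  rewrite -(@eq_measure_integral _ _ _ _ mu2 mu1); last first.
    move=> A' mA' _; exact: IH (ltnW kd) mA'.
  rewrite [RHS](ge0_integral_pushforward mrr)// [RHS]integral_mkcond.
  apply: eq_integral => w _; rewrite patchE.
  have splice_rr w' : rosenblatt_rec Q k x (unif (splice k w w')) =
      rosenblatt_rec Q k x (unif w).
    by apply: eq_rosenblatt_rec => j jk; rewrite !mxE /splice jk.
  have splice_k w' : splice k w w' k = w' 0%N by rewrite /splice ltnn subnn.
  transitivity (P [set w' | A (rosenblatt_rec Q k x (unif w)) /\
      B (ginv (cond_cdf Q i x (rosenblatt_rec Q k x (unif w))) (val (w' 0%N)))]).
    by congr (P _); apply/seteqP; split=> w' /=; rewrite splice_rr splice_k.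
  case: ifPn => [/set_mem/= Aw|/negP]; last first.
    rewrite inE => Aw.
    transitivity (P set0); last by rewrite measure0.
    by congr (P _); apply/seteqP; split=> w' // [].
  (* Puts the kernel at the point where [cond_cdf] evaluates it. *)
  rewrite -[in RHS]prefix_rosenblatt_rec.
  transitivity (P [set w' |
      B (ginv (cond_cdf Q i x (rosenblatt_rec Q k x (unif w))) (val (w' 0%N)))]).
    by congr (P _); apply/seteqP; split=> w' => [[_ Bw]|Bw];
      [exact: Bw|exact: conj Aw Bw].
  exact: (ginv_uniform_law Pprod (Q i)).
- by move=> _; exact: (le_lt_trans (probability_le1 P measurableT) (ltry _)).
Qed.

End rosenblatt_law.

(** * Volume of balls *)

Section integral_lower_bound.
Import HBNNSimple.

(** [f] is not assumed measurable: c times the indicator of [D] is one of the simple functions in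
    the supremum that defines the integral. *)
Lemma ge0_integral_ge_cst disp (T : measurableType disp) (R : realType)
    (mu : {measure set T -> \bar R}) (D : set T) (f : T -> \bar R) (c : R) :
  measurable D -> 0 <= c -> (forall x, D x -> c%:E <= f x)%E ->
  (c%:E * mu D <= \int[mu]_(x in D) f x)%E.
Proof.
move=> mD c0 cf; rewrite integral_mkcond ge0_integralTE; last first.
  by apply: erestrict_ge0 => x Dx; apply: le_trans (cf x Dx); rewrite lee_fin.
rewrite -(sintegral_indic mu D) -(sintegralrM mu c (indic_nnsfun R mD)).
apply: ereal_sup_ubound; exists (scale_nnsfun (indic_nnsfun R mD) c0) => //= x.
rewrite patchE /= /mindic indicE; case: ifPn => xD /=; rewrite ?mulr1 ?mulr0//.
by apply: cf; rewrite inE in xD.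
Qed.

End integral_lower_bound.

(** A sup-norm ball is a product of intervals of length 2e, and [snoc] splits off the last one. *)
Lemma lebesgue_rV_ball (R : realType) n (x : 'rV[R]_n) (e : R) : 0 < e ->
  lebesgue_rV R n (ball x e) = ((e *+ 2) ^+ n)%:E.
Proof.
move=> e0; elim: n x => [|n IH] x /=.
  rewrite /dirac /= indicE mem_set ?expr0//.
  by split=> // i [].
rewrite /lebesgue_snoc /pushforward.
pose x' : 'rV[R]_n := \row_j x ord0 (lift ord_max j).
have -> : @snoc R n @^-1` ball x e = ball x' e `*` ball (x ord0 ord_max) e.
  apply/seteqP; split=> -[y t] /=.
    move=> [_ yt]; split; [split=> // i j|].
      by have := yt ord0 (lift ord_max j); rewrite !mxE liftK (ord1 i).
    by have := yt ord0 ord_max; rewrite mxE unlift_none.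
  move=> [[_ xy] xt]; split=> // i j; rewrite (ord1 i) mxE.
  have [k ->|->] := unliftP ord_max j; rewrite ?liftK ?unlift_none//.
  by have := xy ord0 k; rewrite mxE.
rewrite product_measure1E//; last 2 first.
  by apply: open_measurable_mx; exact: ball_open.
  by apply: open_measurable; exact: ball_open.
by rewrite IH [X in (_ * X)%E]lebesgue_measure_ball ?ltW// -EFinM exprSr.
Qed.

(** * The annealing chain *)

Section chain.
Variables (R : realType) (d : nat).
Local Notation T := 'rV[R]_d.
Variables (X : set T) (Q : nat -> 'I_d -> R.-pker (T * T)%type ~> R).
Hypothesis mX : measurable X.

Lemma rosenblatt_inv_in n (x u : T) : X x -> X (rosenblatt_inv X (Q n) x u).
Proof.
by move=> Xx; rewrite /rosenblatt_inv; case: ifPn => // /set_mem.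
Qed.

Lemma measurable_rosenblatt_inv disp (Y : measurableType disp) n (f g : Y -> T) :
  measurable_fun setT f -> measurable_fun setT g ->
  (forall y j, 0 <= g y ord0 j < 1) ->
  measurable_fun setT (fun y => rosenblatt_inv X (Q n) (f y) (g y)).
Proof.
move=> mf mg g01.
have mr := measurable_rosenblatt_rec (Q n) d mf mg g01.
apply: measurable_fun_ifT => //; apply: (measurable_fun_bool true).
rewrite (_ : _ @^-1` _ = (fun y => rosenblatt_rec (Q n) d (f y) (g y)) @^-1` X).
  exact: mr.
by apply/seteqP; split=> y; [exact: set_mem|exact: mem_set].
Qed.

Variables (phi : T -> R) (temp : nat -> R) (x0 : T).
Hypotheses (phimeas : measurable_fun X phi) (Xx0 : X x0).

Definition chain n (w : Omega R) : T := sa X Q phi temp n x0 (fun j => U0 d j w).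

Definition proposal n (w : Omega R) : T :=
  rosenblatt_inv X (Q n) (chain n.-1 w) (lsubmx (U0 d n w)).

(** The last entry of [U0 d n w]. *)
Definition coin n (w : Omega R) : R := val (w (n * (d + 1) + 1 + d)%N).

Lemma chainS n w : chain n.+1 w =
  if coin n.+1 w <= acceptance phi temp n.+1 (chain n w) (proposal n.+1 w)
  then proposal n.+1 w else chain n w.
Proof.
rewrite {1}/chain /= /sa_step -/(chain n w) -/(proposal n.+1 w).
by rewrite !mxE /= addn0.
Qed.

Lemma chain_in n w : X (chain n w).
Proof.
elim: n => [//|n IH]; rewrite chainS; case: ifP => // _.
exact: rosenblatt_inv_in.
Qed.

Lemma proposal_in n w : X (proposal n w).
Proof. by apply: rosenblatt_inv_in; exact: chain_in. Qed.

Lemma lsubmx_U0E n (w : Omega R) j :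
  lsubmx (U0 d n w) ord0 j = val (w (n * (d + 1) + 1 + j)%N).
Proof. by rewrite !mxE. Qed.

Lemma measurable_lsubmx_U0 n :
  measurable_fun setT (fun w : Omega R => lsubmx (U0 d n w)).
Proof.
apply: measurable_fun_rV => j; under eq_fun do rewrite lsubmx_U0E.
exact: measurable_omega.
Qed.

Lemma measurable_proposal_chain n :
  measurable_fun setT (chain n) -> measurable_fun setT (proposal n.+1).
Proof.
move=> mc; apply: measurable_rosenblatt_inv => //.
  exact: measurable_lsubmx_U0.
by move=> w j; rewrite lsubmx_U0E; exact: val_omega01.
Qed.

Lemma measurable_chain n : measurable_fun setT (chain n).
Proof.
elim: n => [|n IH]; first exact: measurable_cst.
have mp := measurable_proposal_chain IH.
rewrite (funext (chainS n)).
apply: measurable_fun_ifT => //; apply: measurable_fun_ler.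
  exact: measurable_omega.
apply: measurable_minr; first exact: measurable_cst.
apply: measurableT_comp => //.
apply: measurable_funM; last exact: measurable_cst.
apply: measurable_funB.
  (* [phi] is measurable on [X] only, so both states must be known to stay in [X]. *)
  by apply: (measurable_comp mX _ phimeas mp) => _ [w _ <-]; exact: proposal_in.
by apply: (measurable_comp mX _ phimeas IH) => _ [w _ <-]; exact: chain_in.
Qed.

Lemma measurable_proposal n : measurable_fun setT (proposal n.+1).
Proof. exact: (measurable_proposal_chain (measurable_chain n)). Qed.

(** The last coordinate read up to a time n >= 1 is the coin, of index n (d + 1) + 1 + d. *)
Lemma chain_splice m n w w' : (n * (d + 1) + d + 2 <= m)%N ->
  chain n (splice m w w') = chain n w.
Proof.
elim: n => [//|n IH] nm.
have IHn : chain n (splice m w w') = chain n w.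
  by apply: IH; move: nm; rewrite mulSn; lia.
have U : lsubmx (U0 d n.+1 (splice m w w')) = lsubmx (U0 d n.+1 w).
  apply/rowP => j; rewrite !lsubmx_U0E /splice ifT//.
  have := ltn_ord j; lia.
have C : coin n.+1 (splice m w w') = coin n.+1 w.
  by rewrite /coin /splice ifT//; lia.
by rewrite !chainS /proposal IHn U C.
Qed.

Lemma proposal_splice m n w w' : (n.+1 * (d + 1) + d + 1 <= m)%N ->
  proposal n.+1 (splice m w w') = proposal n.+1 w.
Proof.
move=> nm; rewrite /proposal chain_splice; last by rewrite mulSn in nm *; lia.
congr rosenblatt_inv; apply/rowP => j; rewrite !lsubmx_U0E /splice ifT//.
have := ltn_ord j; lia.
Qed.

(** The Markov property. The cut is at the first coordinate of block [n.+1]: the current state lies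
    entirely before it, the uniforms of the proposal entirely after it. *)
Lemma proposal_splice_new n w w' :
  proposal n.+1 (splice (n.+1 * (d + 1) + 1) w w') =
  rosenblatt_inv X (Q n.+1) (chain n w) (unif d w').
Proof.
rewrite /proposal chain_splice; last by rewrite mulSn; lia.
congr rosenblatt_inv; apply/rowP => j; rewrite !lsubmx_U0E mxE /splice.
by rewrite ltnNge leq_addr/= addKn.
Qed.

End chain.

(** * Proposals hit B infinitely often *)

Section hitting.
Variables (R : realType) (d : nat).
Local Notation T := 'rV[R]_d.
Variables (X : set T) (Q : nat -> 'I_d -> R.-pker (T * T)%type ~> R).
Variables (phi : T -> R) (temp : nat -> R) (x0 : T).
Hypotheses (mX : measurable X) (phimeas : measurable_fun X phi) (Xx0 : X x0).
Variable K : nat -> R.-pker T ~> T.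
Hypothesis Qcond : forall n, (1 <= n)%N -> is_cond_distr X (K n) (Q n).
Variable P : probability (Omega R) R.
Hypothesis Pprod : is_product_lebesgue P.
Variables (B : set T) (c : nat -> R).
Hypotheses (mB : measurable B) (BX : B `<=` X).
Hypothesis c_ge0 : forall n, (1 <= n)%N -> 0 <= c n.
Hypothesis c_le : forall n, (1 <= n)%N -> forall x, X x -> ((c n)%:E <= K n x B)%E.

Local Notation proposal := (proposal X Q phi temp x0).
Local Notation chain := (chain X Q phi temp x0).

(** As [B] lies in [X], a transform landing in [B] is not replaced by the fallback value, so a miss
    of [rosenblatt_inv] is a miss of [rosenblatt_rec], whose law is [K n x]. *)
Lemma prob_miss_le n x : (1 <= n)%N -> X x ->
  (P [set w | ~ B (rosenblatt_inv X (Q n) x (unif d w))] <= (1 - c n)%:E)%E.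
Proof.
move=> n1 Xx.
have mr : measurable_fun setT (fun w => rosenblatt_rec (Q n) d x (unif d w)).
  apply: measurable_rosenblatt_rec => //; first exact: measurable_unif.
  by move=> w j; rewrite mxE; exact: val_omega01.
have mi : measurable_fun setT (fun w => rosenblatt_inv X (Q n) x (unif d w)).
  apply: measurable_rosenblatt_inv => //; first exact: measurable_unif.
  by move=> w j; rewrite mxE; exact: val_omega01.
have mrB : measurable [set w | B (rosenblatt_rec (Q n) d x (unif d w))].
  by rewrite -[X in measurable X]setTI; exact: mr.
apply: (@le_trans _ _ (P (~` [set w | B (rosenblatt_rec (Q n) d x (unif d w))]))).
  apply: le_measure; rewrite ?inE.
  - rewrite -[X in measurable X]setTI.
    by apply: (mi measurableT (~` B)); exact: measurableC.
  - exact: measurableC.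
  - move=> w /= nB Br; apply: nB; rewrite /rosenblatt_inv.
    by rewrite mem_set//; exact: BX.
rewrite probability_setC// (rosenblatt_rec_law (Qcond n1))//.
under eq_set do rewrite prefix_id.
by rewrite EFinB; apply: leeB => //; exact: c_le.
Qed.

Lemma hit_bound_le1 n : (1 <= n)%N -> c n <= 1.
Proof.
move=> n1; rewrite -lee_fin; apply: le_trans (c_le n1 Xx0) _.
rewrite -(prob_kernel (s := K n) x0).
by apply: le_measure; rewrite ?inE.
Qed.

(** Index [n] stands for the proposal [n.+1], drawn from [chain n]; the finite window allows
    induction on [N]. *)
Definition miss (m N : nat) : set (Omega R) :=
  [set w | forall n, (m <= n < m + N)%N -> ~ B (proposal n.+1 w)].

Lemma measurable_miss1 n : measurable [set w | ~ B (proposal n.+1 w)].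
Proof.
rewrite -[X in measurable X]setTI.
apply: (@measurable_proposal _ _ _ Q mX _ temp _ phimeas Xx0 n measurableT (~` B)).
exact: measurableC.
Qed.

Lemma missS m N : miss m N.+1 = miss m N `&` [set w | ~ B (proposal (m + N).+1 w)].
Proof.
apply/seteqP; split=> w.
  by move=> H; split=> [n nN|]; apply: H; lia.
move=> [H HN] n nN; have [->//|nmN] := eqVneq n (m + N)%N.
by apply: H; move/eqP: nmN; lia.
Qed.

Lemma measurable_miss m N : measurable (miss m N).
Proof.
elim: N => [|N IH].
  by rewrite (_ : miss m 0 = setT)//; apply/seteqP; split=> // w _ n; lia.
by rewrite missS; apply: measurableI => //; exact: measurable_miss1.
Qed.

Lemma miss_splice m N w w' :
  miss m N (splice ((m + N).+1 * (d + 1) + 1) w w') <-> miss m N w.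
Proof.
suff E n : (m <= n < m + N)%N -> proposal n.+1
    (splice ((m + N).+1 * (d + 1) + 1) w w') = proposal n.+1 w.
  by split=> H n nN; have := H n nN; rewrite E.
move=> /andP[_ nN]; apply: proposal_splice.
have : (n.+2 * (d + 1) <= (m + N).+1 * (d + 1))%N by rewrite leq_mul2r ltnS nN orbT.
by rewrite [(n.+2 * _)%N]mulSn; lia.
Qed.

(** With the past fixed, the longer run of misses is a past event together with a miss by a fresh
    proposal from a fixed state, to which [prob_miss_le] applies. *)
Lemma prob_missS_le m N :
  (P (miss m N.+1) <= (1 - c (m + N).+1)%:E * P (miss m N))%E.
Proof.
have mN := measurable_miss m N; have mN1 := measurable_miss m N.+1.
have c1 : 0 <= 1 - c (m + N).+1 by rewrite subr_ge0 hit_bound_le1.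
rewrite (probability_splice Pprod ((m + N).+1 * (d + 1) + 1) mN1).
apply: (@le_trans _ _ (\int[P]_w ((1 - c (m + N).+1)%:E * (\1_(miss m N) w)%:E))%E).
  apply: ge0_le_integral => //.
  - exact: measurable_fun_prob_splice.
  - apply: emeasurable_funM; first exact: measurable_cst.
    by apply/measurable_EFinP; exact: measurable_indic.
  - move=> w _.
    have missE w' : miss m N.+1 (splice ((m + N).+1 * (d + 1) + 1) w w') <->
        miss m N w /\ ~ B (rosenblatt_inv X (Q (m + N).+1) (chain (m + N) w) (unif d w')).
      by rewrite missS /= proposal_splice_new miss_splice.
    rewrite indicE; have [/set_mem mw|/negP mw] := boolP (w \in miss m N).
      rewrite mule1.
      apply: le_trans (prob_miss_le _ (chain_in Q phi temp Xx0 (m + N) w)) => //.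
      rewrite le_eqVlt; apply/orP; left; apply/eqP.
      by congr (P _); apply/seteqP; split=> w' => [/missE[]//|nB]; exact/missE.
    rewrite mule0; apply: (@le_trans _ _ (P set0)); last by rewrite measure0.
    rewrite le_eqVlt; apply/orP; left; apply/eqP.
    by congr (P _); apply/seteqP; split=> w' // /missE[/mem_set].
rewrite ge0_integralZl_EFin//; last first.
  by apply/measurable_EFinP; exact: measurable_indic.
by rewrite integral_indic// setIT.
Qed.

Lemma prob_miss_le_expR m N :
  (P (miss m N) <= (expR (- \sum_(i < N) c (m + i).+1))%:E)%E.
Proof.
elim: N => [|N IH].
  by rewrite big_ord0 oppr0 expR0 probability_le1//; exact: measurable_miss.
apply: le_trans (prob_missS_le m N) _.
rewrite big_ord_recr/= [in leRHS]opprD [in leRHS]addrC expRD EFinM.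
apply: lee_pmul => //.
  by rewrite lee_fin subr_ge0 hit_bound_le1.
by rewrite lee_fin; exact: expR_ge1Dx.
Qed.

Lemma measurable_miss_forever m :
  measurable [set w | forall n, (m <= n)%N -> ~ B (proposal n.+1 w)].
Proof.
rewrite (_ : [set _ | _] = \bigcap_N miss m N).
  by apply: bigcap_measurable => // N _; exact: measurable_miss.
apply/seteqP; split=> [w H N _ n /andP[mn _]|w H n mn]; first exact: H.
by apply: (H (n - m).+1 I); lia.
Qed.

Lemma prob_miss_forever m : (\sum_(1 <= n <oo) (c n)%:E = +oo)%E ->
  P [set w | forall n, (m <= n)%N -> ~ B (proposal n.+1 w)] = 0%E.
Proof.
move=> coo.
have mforever := measurable_miss_forever m.
apply/eqP; rewrite -measure_le0; apply/lee_addgt0Pr => e e0; rewrite add0e.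
have : \sum_(1 <= n < N) (c n)%:E @[N --> \oo] --> +oo%E.
  rewrite -coo; apply: is_cvg_nneseries_cond => n n1 _.
  by rewrite lee_fin c_ge0.
(* With this threshold the terms up to [m] cancel, and the remaining ones sum to at least - ln e, so
   that exp(- sum) <= e. *)
move/cvgeyPge/(_ (\sum_(1 <= n < m.+1) c n - ln e)) => [N _ /(_ (m.+1 + N)%N)/= ].
rewrite leq_addl => /(_ isT).
rewrite sumEFin lee_fin [leRHS](big_cat_nat _ (n := m.+1))//= ?leq_addr//.
rewrite lerD2l => h.
apply: (@le_trans _ _ (P (miss m N))).
  apply: le_measure; rewrite ?inE//; first exact: measurable_miss.
  by move=> w H n /andP[mn _]; exact: H.
apply: le_trans (prob_miss_le_expR m N) _.
rewrite lee_fin -[leRHS]lnK ?posrE// ler_expR lerNl.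
apply: le_trans h _.
rewrite -{1}[m.+1]add0n big_addn [(m.+1 + N)%N]addnC addnK big_mkord.
by under eq_bigr do rewrite addnC addSn.
Qed.

End hitting.

(** * Near-monotonicity of the values *)

Section coins.
Variable R : realType.
Variable P : probability (Omega R) R.
Hypothesis Pprod : is_product_lebesgue P.

Lemma probability_omega i B : measurable B ->
  P [set w | B (val (w i))] = lebesgue_measure (B `&` `[0%R, 1%R[).
Proof.
move=> mB; rewrite (probability_splice Pprod i).
  rewrite -(probability_omega0 Pprod mB).
  transitivity (\int[P]_(w in setT) (cst (P [set w' | B (val (w' 0%N))]) w))%E.
    apply: eq_integral => w _; rewrite /cst; congr (P _); apply/seteqP.
    by split=> w'; rewrite /= /splice ltnn subnn.
  by rewrite integral_cst// [X in (_ * X)%E](@probability_setT _ _ _ P) mule1.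
by rewrite -[X in measurable X]setTI; apply: (measurable_omega i).
Qed.

Lemma probability_omega_lt i p : 0 <= p <= 1 ->
  P [set w | val (w i) < p] = p%:E.
Proof.
move=> /andP[p0 p1].
rewrite (probability_omega i (B := `]-oo, p[%classic))//.
rewrite (_ : _ `&` _ = `[0%R, p[%classic).
  rewrite [LHS]lebesgue_measure_itv/= lte_fin sube0.
  by case: ltP => // ?; congr EFin; apply/le_anti; rewrite p0.
apply/seteqP; split=> t /=; rewrite !in_itv/=.
  by move=> [-> /andP[->]].
by move=> /andP[-> tp]; rewrite tp (lt_le_trans tp p1).
Qed.

(** Telescoping: each term is 1/(n+1) - 1/(n+2). *)
Lemma series_inv_pronic_le1 :
  (\sum_(n <oo) ((n.+1%:R * n.+2%:R : R)^-1)%:E <= 1)%E.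
Proof.
apply: lime_le.
  by apply: is_cvg_nneseries => n _ _; rewrite lee_fin invr_ge0 mulr_ge0.
apply: nearW => N; rewrite sumEFin lee_fin.
rewrite (eq_big_nat _ _ (F2 := fun n => - (n.+2%:R : R)^-1 - (- (n.+1%:R)^-1))); last first.
  move=> n _; rewrite opprK.
  have n1 : n.+1%:R != 0 :> R by rewrite pnatr_eq0.
  have n2 : n.+2%:R != 0 :> R by rewrite pnatr_eq0.
  apply: (mulfI (mulf_neq0 n1 n2)); rewrite mulfV ?mulf_neq0// mulrDr mulrN.
  rewrite mulfK// [_ * n.+2%:R in RHS]mulrC mulfK// -natr1; ring.
rewrite telescope_sumr//.
by rewrite opprK invr1 addrC gerDl oppr_le0 invr_ge0.
Qed.

(** First Borel-Cantelli lemma: each exceptional event has its threshold as probability. *)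
Lemma omega_eventually_ge (idx : nat -> nat) :
  P.-negligible [set w | ~ exists N, forall n, (N <= n)%N ->
    (n.+1%:R * n.+2%:R)^-1 <= val (w (idx n))].
Proof.
pose F n := [set w : Omega R | val (w (idx n)) < (n.+1%:R * n.+2%:R)^-1].
have mF n : measurable (F n).
  rewrite -[X in measurable X]setTI.
  have := @measurable_omega R (idx n) measurableT.
  by move=> /(_ `]-oo, (n.+1%:R * n.+2%:R)^-1[%classic); apply.
exists (lim_sup_set F); split.
- by apply: bigcap_measurable => // n _; apply: bigcup_measurable.
- apply: lim_sup_set_cvg0 => //.
  apply: le_lt_trans (ltry (1 : R)). apply: le_trans series_inv_pronic_le1.
  apply: lee_nneseries => // n _.
  have p01 : 0 <= (n.+1%:R * n.+2%:R : R)^-1 <= 1.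
    by rewrite invr_ge0 mulr_ge0//= invf_le1 ?mulr_gt0// -natrM ler1n.
  by rewrite [leLHS](probability_omega_lt _ p01).
- move=> w /forallNP H N _.
  have /existsNP[n /not_implyP[Nn /negP]] := H N.
  by rewrite -ltNge; exists n.
Qed.

End coins.

(** Start from a time when the value is within e/2 of [s] and the losses still to come total at most
    e/2: the value never drops below [s - e] afterwards. *)
Lemma cvg_of_near_monotone (R : realType) (a c : nat -> R) (s : R) :
  (forall n, a n <= s) -> (forall n, 0 <= c n) ->
  (\sum_(n <oo) (c n)%:E < +oo)%E ->
  (exists N, forall n, (N <= n)%N -> a n - c n.+1 <= a n.+1) ->
  (forall e, 0 < e -> forall m, exists2 n, (m <= n)%N & s - e <= a n) ->
  a n @[n --> \oo] --> s.
Proof.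
move=> as_ c0 coo [N0 aN] io; apply/cvgrPdist_le => e e0.
have e20 : 0 < e / 2 by rewrite divr_gt0.
have [N1 _ cN1] : \forall N \near \oo, (\sum_(N <= k <oo) (c k)%:E <= (e / 2)%:E)%E.
  have := nneseries_tail_cvg coo (fun k _ => c0 k : (0 <= (c k)%:E)%E).
  move=> /(_ [set y | y <= (e / 2)%:E]%E); apply.
  have := @open_ereal_lt' _ 0%E (e / 2)%:E; rewrite lte_fin => /(_ e20).
  by apply: filterS => y /ltW.
have [n0 n0N an0] := io _ e20 (maxn N0 N1).
have tail j : \sum_(n0 <= k < n0 + j) c k.+1 <= e / 2.
  rewrite -(big_add1 _ _ n0 (n0 + j).+1 xpredT c) -lee_fin -sumEFin.
  apply: le_trans (nneseries_lim_ge _ _) _ => [k _ _|]; first by rewrite lee_fin.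
  by apply: cN1; rewrite /=; lia.
have an j : a n0 - \sum_(n0 <= k < n0 + j) c k.+1 <= a (n0 + j)%N.
  elim: j => [|j IH]; first by rewrite addn0 big_geq// subr0.
  rewrite addnS big_nat_recr ?leq_addr//= opprD addrA.
  apply: le_trans (aN _ _); last by lia.
  by rewrite lerD2r.
near=> n.
have -> : n = (n0 + (n - n0))%N.
  by rewrite subnKC//; near: n; exact: nbhs_infty_ge.
rewrite ger0_norm ?subr_ge0// lerBlDr -lerBlDl.
apply: le_trans (an _); have := tail (n - n0)%N; lra.
Unshelve. all: by end_near. Qed.

Section annealing_steps.
Variables (R : realType) (d : nat).
Local Notation T := 'rV[R]_d.
Variables (X : set T) (Q : nat -> 'I_d -> R.-pker (T * T)%type ~> R).
Variables (phi : T -> R) (temp : nat -> R) (x0 : T).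
Local Notation proposal := (proposal X Q phi temp x0).
Local Notation chain := (chain X Q phi temp x0).

(** Stated with a positive lower bound [u] of the coin, because the coin itself can be 0. On
    rejection the value is unchanged and [ln u <= 0]. *)
Lemma chain_descent n w (u : R) : 0 < temp n.+1 -> 0 < u <= coin d n.+1 w ->
  u <= 1 -> phi (chain n w) + temp n.+1 * ln u <= phi (chain n.+1 w).
Proof.
move=> T0 /andP[u0 uw] u1; rewrite chainS; case: ifPn => [acc|_]; last first.
  by rewrite gerDl mulr_ge0_le0 ?ln_le0// ltW.
have := le_trans uw acc; rewrite le_min => /andP[_].
rewrite -{1}(lnK u0) ler_expR ler_pdivlMr// mulrC; lra.
Qed.

(** If the current value is below [s], the proposal is an ascent, its acceptance probability is 1,
    and no coin exceeds 1. *)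
Lemma chain_hit n w (s : R) : 0 < temp n.+1 -> s <= phi (proposal n.+1 w) ->
  s <= phi (chain n w) \/ s <= phi (chain n.+1 w).
Proof.
move=> T0 sp; have [sc|cs] := leP s (phi (chain n w)); [by left|right].
rewrite chainS ifT//.
have /andP[_ /ltW c1] := val_omega01 w (n.+1 * (d + 1) + 1 + d).
rewrite le_min c1 (le_trans c1)//.
rewrite -[leLHS]expR0 ler_expR divr_ge0 ?ltW//.
by rewrite subr_gt0 (lt_le_trans cs).
Qed.

End annealing_steps.

(** The 3 comes from n + 2 <= (n + 1)^2, which fails at n = 0. *)
Lemma ln_pronic (R : realType) n : (1 <= n)%N ->
  - (3 * ln n.+1%:R) <= ln ((n.+1%:R * n.+2%:R)^-1 : R).
Proof.
move=> n1; rewrite lnV ?posrE ?mulr_gt0// lnM ?posrE// lerN2.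
suff : ln (n.+2%:R : R) <= 2 * ln n.+1%:R by lra.
rewrite mulr_natl -lnXn// ler_ln ?posrE ?exprn_gt0//.
by rewrite -natrX ler_nat -mulnn; nia.
Qed.

(** Continuity is relative to the closed ball, so the radius it yields is capped by [r]. *)
Lemma ball_lower_bound (R : realType) d (phi : 'rV[R]_d -> R) (x : 'rV[R]_d)
    (r e : R) :
  0 < r -> {within [set y | `|y - x| <= r], continuous phi} -> 0 < e ->
  exists r', [/\ 0 < r', ball x r' `<=` [set y | `|y - x| <= r] &
    forall y, ball x r' y -> phi x - e <= phi y].
Proof.
move=> r0 /subspace_continuousP/(_ x) H e0.
have /H/cvgrPdist_le/(_ _ e0) : `|x - x| <= r by rewrite subrr normr0 ltW.
rewrite near_withinE => /nbhs_ballP[/= r1 r10 r1P].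
have sub : ball x (Num.min r1 r) `<=` [set y | `|y - x| <= r].
  move=> y xy; have {xy} : ball x r y.
    by apply: le_ball xy; rewrite ge_min lexx orbT.
  by rewrite -ball_normE /= distrC => /ltW.
exists (Num.min r1 r); split => //; first by rewrite lt_min r10.
move=> y xy.
have xy1 : ball x r1 y by apply: le_ball xy; rewrite ge_min lexx.
have : `|phi x - phi y| <= e := r1P y xy1 (sub _ xy).
by rewrite ler_norml => /andP[_]; lra.
Qed.

Theorem theorem1 (R : realType) (d : nat) (hd : (1 <= d)%N)
  (X : set 'rV[R]_d) (Xbounded : bounded_set X) (Xmeas : measurable X)
  (K : nat -> R.-pker 'rV[R]_d ~> 'rV[R]_d)
  (KX : forall n, (1 <= n)%N -> forall x, X x -> K n x X = 1%E)
  (k : nat -> 'rV[R]_d * 'rV[R]_d -> R) (Kmin : nat -> R)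
  (Kdensity : forall n, (1 <= n)%N -> forall x, X x ->
     forall B, measurable B ->
     K n x B = (\int[lebesgue_rV R d]_(y in B `&` X) (k n (x, y))%:E)%E)
  (kcont : forall n, (1 <= n)%N -> {within X `*` X, continuous (k n)})
  (Kmin_gt0 : forall n, (1 <= n)%N -> 0 < Kmin n)
  (k_ge : forall n, (1 <= n)%N ->
     forall x y, X x -> X y -> Kmin n <= k n (x, y))
  (Kmin_sum : (\sum_(1 <= n <oo) (Kmin n)%:E = +oo)%E)
  (Q : nat -> 'I_d -> R.-pker ('rV[R]_d * 'rV[R]_d)%type ~> R)
  (Qcond : forall n, (1 <= n)%N -> is_cond_distr X (K n) (Q n))
  (phi : 'rV[R]_d -> R) (phimeas : measurable_fun X phi)
  (phistar : \bar R)
  (phistar_sup : phistar = ereal_sup [set (phi x)%:E | x in X])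
  (xstar : 'rV[R]_d) (Xxstar : X xstar) (phi_xstar : (phi xstar)%:E = phistar)
  (delta0 : R) (delta0_gt0 : 0 < delta0)
  (ballX : [set x | `|x - xstar| <= delta0] `<=` X)
  (phicont : {within [set x | `|x - xstar| <= delta0], continuous phi})
  (temp : nat -> R) (temp_gt0 : forall n, (1 <= n)%N -> 0 < temp n)
  (temp_sum : (\sum_(1 <= n <oo) (temp n * ln n%:R)%:E < +oo)%E)
  (P : probability (Omega R) R) (Pprod : is_product_lebesgue P)
  (x0 : 'rV[R]_d) (Xx0 : X x0) :
  {ae P, forall w,
    (phi (sa X Q phi temp n x0 (fun j => U0 d j w)))%:E @[n --> \oo]
      --> phistar}.
Proof.
have phi_le x : X x -> phi x <= phi xstar.
  move=> Xx; rewrite -lee_fin phi_xstar phistar_sup.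
  by apply: ereal_sup_ubound; exists x.
pose a w n := phi (chain X Q phi temp x0 n w).
have descent : {ae P, forall w, exists N, forall n, (N <= n)%N ->
    a w n - 3 * (temp n.+1 * ln n.+1%:R) <= a w n.+1}.
  apply: negligibleS (omega_eventually_ge Pprod (fun n => (n.+1 * (d + 1) + 1 + d)%N)).
  move=> w /= nd [N coinN]; apply: nd; exists (maxn N 1) => n.
  rewrite geq_max => /andP[Nn n1].
  have p0 : 0 < (n.+1%:R * n.+2%:R : R)^-1 by rewrite invr_gt0 mulr_gt0.
  have p1 : (n.+1%:R * n.+2%:R : R)^-1 <= 1.
    by rewrite invf_le1 ?mulr_gt0// -natrM ler1n.
  have p01 : 0 < (n.+1%:R * n.+2%:R : R)^-1 <= coin d n.+1 w.
    by rewrite p0; exact: coinN.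
  have := chain_descent X Q phi x0 (temp_gt0 _ (ltn0Sn n)) p01 p1.
  apply: le_trans; rewrite lerD2l mulrCA -mulrN ler_pM2l ?temp_gt0//.
  exact: ln_pronic.
(* Tolerances 1/(j+1) instead of all e > 0: only countably many null sets are discarded. *)
have near_max j : {ae P, forall w m, exists2 n, (m <= n)%N &
    phi xstar - j.+1%:R^-1 <= a w n}.
  have e0 : 0 < j.+1%:R^-1 :> R by rewrite invr_gt0.
  have [r [r0 rX rphi]] := ball_lower_bound delta0_gt0 phicont e0.
  have v0 : 0 < (r *+ 2) ^+ d :> R by rewrite exprn_gt0// mulrn_wgt0.
  have BX : ball xstar r `<=` X by apply: subset_trans rX ballX.
  have mB : measurable (ball xstar r) by apply: open_measurable_mx; exact: ball_open.
  pose c n := (r *+ 2) ^+ d * Kmin n.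
  have c_ge0 n : (1 <= n)%N -> 0 <= c n.
    by move=> n1; rewrite mulr_ge0 ?ltW// Kmin_gt0.
  have c_le n : (1 <= n)%N -> forall x, X x -> ((c n)%:E <= K n x (ball xstar r))%E.
    move=> n1 x Xx; rewrite Kdensity// setIidl//.
    rewrite EFinM muleC -(lebesgue_rV_ball xstar r0).
    apply: ge0_integral_ge_cst => //; first exact/ltW/Kmin_gt0.
    by move=> y /BX Xy; rewrite lee_fin k_ge.
  have coo : (\sum_(1 <= n <oo) (c n)%:E = +oo)%E.
    rewrite eseries_cond; under eq_eseriesr do rewrite EFinM.
    rewrite nneseriesZl => [|n /andP[_ n1]]; last by rewrite lee_fin ltW// Kmin_gt0.
    by rewrite -eseries_cond Kmin_sum gt0_muley// lte_fin.
  apply: ae_foralln => m.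
  exists [set w | forall n, (m <= n)%N -> ~ ball xstar r (proposal X Q phi temp x0 n.+1 w)].
  split.
  - exact: measurable_miss_forever.
  - exact: (prob_miss_forever temp Xmeas phimeas Xx0 Qcond Pprod mB BX c_ge0 c_le m coo).
  - move=> w /= H n mn hit; apply: H.
    have [h|h] := chain_hit (temp_gt0 _ (ltn0Sn n)) (rphi _ hit).
      by exists n.
    by exists n.+1 => //; exact: leqW.
(* [ln 0 = 0] by convention: the term of index 0 vanishes whatever [temp 0] is, so this series may
   start at 0. *)
have c_ge0 n : 0 <= 3 * (temp n * ln n%:R).
  case: n => [|n]; first by rewrite ln0// !mulr0.
  by rewrite !mulr_ge0// ?ln_ge0 ?ler1n// ltW// temp_gt0.
have c_fin : (\sum_(n <oo) (3 * (temp n * ln n%:R))%:E < +oo)%E.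
  rewrite nneseries_recl//; last by move=> n _; rewrite lee_fin.
  under eq_eseriesr do rewrite EFinM.
  rewrite nneseriesZl; last first.
    by move=> n _; have := c_ge0 n; rewrite lee_fin pmulr_rge0.
  by rewrite ln0// !mulr0 add0e lte_mul_pinfty// lee_fin.
have /ae_foralln {}near_max := near_max.
apply: filterS2 descent near_max => w [N aN] near_max.
rewrite -phi_xstar; apply: cvg_EFin; first exact: nearW.
apply: (@cvg_of_near_monotone _ _ (fun n => 3 * (temp n * ln n%:R))).
- by move=> n; exact: (phi_le _ (chain_in Q phi temp Xx0 n w)).
- exact: c_ge0.
- exact: c_fin.
- by exists N.
- move=> e e0 m.
  have [j je] : exists j : nat, j.+1%:R^-1 <= e.
    have [j _ /(_ _ (leqnn j))/ltW] := near_infty_natSinv_lt (PosNum e0).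
    by exists j.
  have [n mn an] := near_max j m; exists n => //.
  by apply: le_trans an; rewrite lerD2l lerN2.
Qed.
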